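(* Let $N=1$ and let $1\leq d_1<d_2$ be integers. The Hilbert scheme $H_{d_1,d_2}$ of punctual complete intersections contains complete curves.
   Context: We work over an algebraically closed field $\mathbf{k}$ of arbitrary characteristic. Let $S_l=H^0(\mathbb{P}^1,\mathcal{O}(l))$ be the space of homogeneous polynomials of degree $l$ in $X_0,X_1$. Let $\bar{H}_{d_1,d_2}\to\mathbb{P}(S_{d_1})$ be the projective bundle whose fiber over $\langle F\rangle$ is the space of lines in $S_{d_2}/(F\cdot S_{d_2-d_1})$, with points written $[F,G]$ ($F\neq 0$, $F\nmid G$). $H_{d_1,d_2}\subset\bar{H}_{d_1,d_2}$ is the open subset of those $[F,G]$ such that $F$ and $G$ have no common root in $\mathbb{P}^1$. (It is a locally closed subset of the punctual Hilbert scheme of $\mathbb{A}^2$ via $[F,G]\mapsto\{F=G=0\}\subset\mathbb{A}^2$.) A complete curve in $H_{d_1,d_2}$ is an integral closed subscheme of dimension $1$ that is proper over $\mathbf{k}$. *)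

(* Defs.v *)
From HB Require Import structures.
From mathcomp Require Import all_boot all_order all_algebra.
From mathcomp Require Import boolp classical_sets.
From mathcomp Require Import mpoly.

Set Implicit Arguments.
Unset Strict Implicit.
Unset Printing Implicit Defensive.

Import GRing.Theory.
Local Open Scope quotient_scope.
Local Open Scope classical_set_scope.
Local Open Scope ring_scope.

(* Classical language of varieties.  Over an algebraically closed field, the
   integral closed subschemes of a quasi-projective variety X correspond, via
   their sets of closed points, to the irreducible Zariski closed subsets of
   X(k), and Krull dimension can be read off X(k).  A space is given below by
   a type of points together with its collection of closed sets. *)

Definition relatively_closed T (closed : set (set T)) (A B : set T) : Prop :=
  exists2 D, closed D & B = A `&` D.

Definition irreducible T (closed : set (set T)) (A : set T) : Prop :=
  A !=set0 /\
  forall D E, closed D -> closed E -> A `<=` D `|` E -> A `<=` D \/ A `<=` E.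

Definition irreducible_chain T (closed : set (set T)) (A : set T) (n : nat)
    (Z : nat -> set T) : Prop :=
  (forall i, (i <= n)%N ->
     irreducible closed (Z i) /\ relatively_closed closed A (Z i)) /\
  (forall i, (i < n)%N -> Z i `<` Z i.+1).

Definition has_krull_dim T (closed : set (set T)) (A : set T) (n : nat) : Prop :=
  (exists Z, irreducible_chain closed A n Z) /\
  (forall m Z, irreducible_chain closed A m Z -> (m <= n)%N).

(* Zariski topology of a finite-dimensional vector space; the choice of the
   basis is immaterial. *)
Definition zariski_closed (k : fieldType) (V : vectType k) (Z : set V) : Prop :=
  exists I : set {mpoly k[\dim {:V}]},
    Z = [set v | forall p, I p -> p.@[fun i => coord (vbasis {:V}) i v] = 0].

Section HilbertScheme.
Variables (k : closedFieldType) (d1 d2 : nat).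

(* S_l, the space of binary forms of degree l *)
Local Notation form l := (dhomog 2 k l).
Local Notation form_val := mpoly_of_dhomog.

Lemma form_valD l (F G : form l) : form_val (F + G) = form_val F + form_val G.
Proof. by []. Qed.

Lemma form_valZ l a (F : form l) : form_val (a *: F) = a *: form_val F.
Proof. by []. Qed.

Definition is_pair (u : form d1 * form d2) : bool :=
  `[< u.1 <> 0 /\
      ~ exists K : form (d2 - d1), form_val u.2 = form_val K * form_val u.1 >].

Definition pairs := {u : form d1 * form d2 | is_pair u}.
HB.instance Definition _ := Choice.on pairs.

(* [F, G] = [F', G'] iff <F> = <F'> and G, G' span the same line in
   S_d2 / (F . S_(d2 - d1)). *)
Definition same_point (u v : pairs) : bool :=
  `[< exists a b : k, exists K : form (d2 - d1),
      [/\ a != 0, b != 0,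
          form_val (val v).1 = a *: form_val (val u).1
        & form_val (val v).2 =
            b *: form_val (val u).2 + form_val K * form_val (val u).1] >].

Lemma same_point_refl : reflexive same_point.
Proof.
move=> u; apply/asboolP; exists 1, 1, 0.
by split; rewrite ?oner_neq0 ?scale1r // [form_val 0](_ : _ = 0) // mul0r addr0.
Qed.

Lemma same_point_symW u v : same_point u v -> same_point v u.
Proof.
move=> /asboolP[a [b [K [a0 b0 e1 e2]]]]; apply/asboolP.
exists a^-1, b^-1, (- (b^-1 * a^-1) *: K).
split; rewrite ?invr_eq0 //.
  by rewrite e1 scalerA mulVf // scale1r.
rewrite e2 e1 form_valZ scalerDr scalerA mulVf // scale1r.
rewrite -scalerAl -scalerAr scalerA mulNr -mulrA mulVf // mulr1 scaleNr.
by rewrite addrK.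
Qed.

Lemma same_point_sym : ssrbool.symmetric same_point.
Proof. by move=> u v; apply/idP/idP; apply: same_point_symW. Qed.

Lemma same_point_trans : transitive same_point.
Proof.
move=> v u w /asboolP[a [b [K [a0 b0 e1 e2]]]].
move=> /asboolP[a' [b' [K' [a0' b0' e1' e2']]]]; apply/asboolP.
exists (a' * a), (b' * b), (b' *: K + a *: K').
split; rewrite ?mulf_neq0 //; first by rewrite e1' e1 scalerA.
rewrite e2' e2 e1 form_valD !form_valZ scalerDr scalerA mulrDl addrA.
by rewrite -!scalerAl -scalerAr.
Qed.

Canonical same_point_equiv :=
  EquivRel same_point same_point_refl same_point_sym same_point_trans.

Definition Hbar := {eq_quot same_point_equiv}.
HB.instance Definition _ := Choice.on Hbar.
HB.instance Definition _ := EqQuotient.on Hbar.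

Definition no_common_root (u : pairs) : Prop :=
  ~ exists x : 'I_2 -> k,
      [/\ exists i, x i != 0, (form_val (val u).1).@[x] = 0
        & (form_val (val u).2).@[x] = 0].

Definition Hset : set Hbar := [set \pi_Hbar u | u in [set u | no_common_root u]].

(* The map (F, G) |-> [F, G] from the open subset of pairs of S_d1 x S_d2 to
   Hbar is a smooth surjection (a torsor under the group of triples (a, b, K)),
   and remains one after a product with an affine space; hence a subset of
   Hbar, or of Hbar x V, is Zariski closed iff its preimage is closed for the
   topology induced by the ambient vector space. *)
Definition closed_Hbar (D : set Hbar) : Prop :=
  exists2 Z : set (form d1 * form d2)%type, zariski_closed Z &
    forall u : pairs, D (\pi_Hbar u) <-> Z (val u).

Definition closed_HbarX (V : vectType k) (D : set (Hbar * V)) : Prop :=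
  exists2 Z : set ((form d1 * form d2) * V)%type, zariski_closed Z &
    forall (u : pairs) (y : V), D (\pi_Hbar u, y) <-> Z (val u, y).

(* Properness over k: a subvariety is separated and of finite type, so what
   remains is universal closedness.  Closedness of Y x C -> Y is local on Y and
   inherited by closed subschemes, so the affine spaces Y are the test cases. *)
Definition complete (C : set Hbar) : Prop :=
  forall (n : nat) (W : set (Hbar * 'rV[k]_n)),
    relatively_closed (@closed_HbarX 'rV[k]_n) (C `*` setT) W ->
    zariski_closed (snd @` W).

Definition complete_curve_in_H (C : set Hbar) : Prop :=
  [/\ C `<=` Hset /\ relatively_closed closed_Hbar Hset C,
      irreducible closed_Hbar C,
      has_krull_dim closed_Hbar C 1
    & complete C].

End HilbertScheme.

(* Main.v *)
Require Import Defs.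
From HB Require Import structures.
From mathcomp Require Import all_boot all_order all_algebra.
From mathcomp Require Import boolp classical_sets mpoly zify.

(** The curve is the image of a morphism from the projective line, constructed
    as follows.  Choose a factor [f] of degree [d1] of the one-variable
    polynomial [Z^d2 - 1] and put, for [(a : b)] in P^1,
      [F_(a,b) = \sum_j f_j (a X0)^j (b X1)^(d1 - j)].
    Homogenising [f g = Z^d2 - 1] shows that [F_(a,b)] divides
    [a^d2 X0^d2 - b^d2 X1^d2].  Hence, when [a] and [b] are nonzero, [X0^d2] and
    [X1^d2] are proportional modulo [F_(a,b)], and
      [ [F_(a,b), X0^d2] = [F_(a,b), X1^d2] ].
    The left-hand side still defines a point of [H] when [a = 0]: as [f_0 <> 0],
    the form [F_(a,b)] does not vanish at [X0 = 0] unless [b = 0].  In the same way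
    the right-hand side still defines one when [b = 0], because [f_d1 <> 0].  The two
    formulas glue to a morphism from P^1 to [H], and it is not constant because
    [F_(0,1)] and [F_(1,0)] are multiples of [X1^d1] and [X0^d1].  The roots of
    [f] are multiple when the characteristic forces it; the argument is the same in
    every characteristic.

    It remains to see that the image of a nonconstant morphism from P^1 is a
    complete curve.
    - Universal closedness is the main theorem of elimination theory for P^1
      ([elimination], applied in [ratcurve_proper]).
    - The relation [same_point] is closed ([closed_dominates]): it says that
      certain families of vectors are linearly dependent.  So points are closed,
      and projecting this relation along the curve shows that the curve is closed.
    - A closed set that does not contain the curve pulls back to the zeros of a
      nonzero polynomial in one variable ([ratcurve_avoid]).  It thus meets the
      curve in finitely many points, which gives irreducibility and dimension
      one. *)

Set Implicit Arguments.
Unset Strict Implicit.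
Unset Printing Implicit Defensive.

Import GRing.Theory.
Local Open Scope quotient_scope.
Local Open Scope classical_set_scope.
Local Open Scope ring_scope.
Local Notation form_val := (@mpoly_of_dhomog _ _ _).

(** * Polynomial functions and closed sets of a vector space *)

Section PolynomialFunctions.
Variable k : fieldType.

Definition coords (V : vectType k) (v : V) (i : 'I_(\dim {:V})) : k :=
  coord (vbasis {:V}) i v.

Definition polyfun (V : vectType k) (f : V -> k) : Prop :=
  exists p : {mpoly k[\dim {:V}]}, forall v, f v = p.@[coords v].

Lemma sum_coords (V : vectType k) (v : V) :
  v = \sum_i coords v i *: (vbasis {:V})`_i.
Proof. exact/coord_vbasis/memvf. Qed.

Section Closure.
Variable V : vectType k.
Implicit Types f g : V -> k.

Lemma polyfun_cst c : polyfun (fun _ : V => c).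
Proof. by exists c%:MP => v; rewrite mevalC. Qed.

Lemma polyfunD f g : polyfun f -> polyfun g -> polyfun (fun v => f v + g v).
Proof.
by move=> [p fp] [q gq]; exists (p + q) => v; rewrite mevalD fp gq.
Qed.

Lemma polyfunM f g : polyfun f -> polyfun g -> polyfun (fun v => f v * g v).
Proof.
by move=> [p fp] [q gq]; exists (p * q) => v; rewrite mevalM fp gq.
Qed.

Lemma polyfun_sum (I : Type) (r : seq I) (F : I -> V -> k) :
  (forall i, polyfun (F i)) -> polyfun (fun v => \sum_(i <- r) F i v).
Proof.
move=> Fp; elim: r => [|i r IH].
  by under eq_fun do rewrite big_nil; exact: polyfun_cst.
by under eq_fun do rewrite big_cons; exact: polyfunD.
Qed.

Lemma polyfun_prod (I : Type) (r : seq I) (F : I -> V -> k) :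
  (forall i, polyfun (F i)) -> polyfun (fun v => \prod_(i <- r) F i v).
Proof.
move=> Fp; elim: r => [|i r IH].
  by under eq_fun do rewrite big_nil; exact: polyfun_cst.
by under eq_fun do rewrite big_cons; exact: polyfunM.
Qed.

Lemma polyfun_det n (X : V -> 'M[k]_n) :
  (forall i j, polyfun (fun v => X v i j)) -> polyfun (fun v => \det (X v)).
Proof.
move=> Xp; apply: polyfun_sum => s; apply: polyfunM; first exact: polyfun_cst.
exact: polyfun_prod.
Qed.

Lemma polyfun_scalar f : scalar f -> polyfun f.
Proof.
move=> lin_f.
pose g : {scalar V} := HB.pack f (GRing.isLinear.Build _ _ _ _ f lin_f).
exists (\sum_(i < \dim {:V}) f (vbasis {:V})`_i *: 'X_i) => v.
rewrite -[f]/(g : V -> k) {1}(sum_coords v) !linear_sum; apply: eq_bigr => i _.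
by rewrite [LHS]linearZ /= mevalZ mevalXU mulrC.
Qed.

Lemma polyfun_coord (W : vectType k) (f : V -> W) j :
  linear f -> polyfun (fun v => coords (f v) j).
Proof.
by move=> lin_f; apply: polyfun_scalar => a u v; rewrite lin_f /coords linearP.
Qed.

Lemma closed_separated (Z : set V) (v : V) :
  zariski_closed Z -> ~ Z v ->
  exists p : {mpoly k[\dim {:V}]},
    p.@[coords v] != 0 /\ forall w, Z w -> p.@[coords w] = 0.
Proof.
move=> [I ->] /= /existsNP[p /not_implyP[Ip /eqP p0]].
by exists p; split=> // w /(_ p Ip).
Qed.

(** The equations may be chosen one point at a time: it suffices to find, for each
    point outside [Z], one polynomial function that vanishes on [Z] and not at that
    point.  Elimination and rank conditions below have explicit equations only
    in this pointwise sense. *)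
Lemma closed_of_separation (Z : set V) :
  (forall v, ~ Z v ->
     exists f, [/\ polyfun f, f v != 0 & forall w, Z w -> f w = 0]) ->
  zariski_closed Z.
Proof.
move=> sepZ; exists [set p | forall w, Z w -> p.@[coords w] = 0].
apply/seteqP; split=> [v Zv p Ip|v Zv]; first exact: Ip.
apply: contrapT => /sepZ[f [[p fp] fv f0]]; move/eqP: fv; apply.
by rewrite fp; apply: Zv => w /f0; rewrite fp.
Qed.

Lemma closed0 : zariski_closed (set0 : set V).
Proof.
apply: closed_of_separation => v _; exists (fun=> 1).
by split; [exact: polyfun_cst|rewrite oner_neq0|].
Qed.

Lemma closedI (Z Z' : set V) :
  zariski_closed Z -> zariski_closed Z' -> zariski_closed (Z `&` Z').
Proof.
move=> [I ->] [I' ->]; exists (I `|` I').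
apply/seteqP; split=> [v [Iv I'v] p [/Iv|/I'v] //|v IUv].
by split=> p Ip; apply: IUv; [left|right].
Qed.

Lemma closedU (Z Z' : set V) :
  zariski_closed Z -> zariski_closed Z' -> zariski_closed (Z `|` Z').
Proof.
move=> cZ cZ'; apply: closed_of_separation => v /not_orP[].
move=> /(closed_separated cZ)[p [pv p0]] /(closed_separated cZ')[q [qv q0]].
exists (fun w => (p * q).@[coords w]); split; first by exists (p * q).
  by rewrite mevalM mulf_neq0.
by move=> w; rewrite mevalM => -[/p0->|/q0->]; rewrite ?mul0r ?mulr0.
Qed.

(** If the rows of [X v] are independent, [X v] has a right inverse [B], and the
    polynomial [\det (X w *m B)] in [w] separates [v] from the set.  Multiplying by
    [B] takes the place of selecting a nonzero maximal minor. *)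
Lemma closed_not_row_free m n (X : V -> 'M[k]_(m, n)) :
  (forall i j, polyfun (fun v => X v i j)) ->
  zariski_closed [set v | ~~ row_free (X v)].
Proof.
move=> Xp; apply: closed_of_separation => v /negP; rewrite negbK => /row_freeP[B XB].
exists (fun w => \det (X w *m B)); split.
- apply: polyfun_det => i j; under eq_fun do rewrite mxE.
  by apply: polyfun_sum => l; apply: polyfunM => //; exact: polyfun_cst.
- by rewrite XB det1 oner_neq0.
move=> w /= Xw; apply/eqP/det0P.
suff /rowV0Pn[x /sub_kermxP xX x0] : kermx (X w) != 0.
  by exists x; rewrite // mulmxA xX mul0mx.
by rewrite kermx_eq0.
Qed.

End Closure.

(** To see how a polynomial function depends on parameters, substitute for its
    variables elements [h i] of a ring [R] of functions of the parameters; the maps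
    [ev] are the evaluations at the values of the parameters. *)
Lemma mmap_eval n (p : {mpoly k[n]}) (R : comNzRingType)
    (iota : {rmorphism k -> R}) (ev : {rmorphism R -> k}) (h : 'I_n -> R) :
  cancel iota ev -> ev (mmap iota h p) = p.@[fun i => ev (h i)].
Proof.
move=> iotaK; rewrite mevalE /mmap rmorph_sum; apply: eq_bigr => m _ /=.
rewrite rmorphM iotaK rmorph_prod; congr (_ * _).
by apply: eq_bigr => i _; rewrite rmorphXn.
Qed.

Lemma row_free_coords (V : vectType k) m (w : 'I_m -> V) :
  reflect (forall x : 'rV_m, \sum_i x 0 i *: w i = 0 -> x = 0)
    (row_free (\matrix_(i, j) coords (w i) j)).
Proof.
set X := (X in row_free X).
have mulX (x : 'rV_m) : x *m X = \row_j coords (\sum_i x 0 i *: w i) j.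
  apply/rowP => j; rewrite !mxE /coords linear_sum; apply: eq_bigr => i _.
  by rewrite linearZ !mxE.
apply: (iffP idP) => [freeX x x0|freew].
  apply: (row_free_inj freeX); rewrite mul0mx mulX x0.
  by apply/rowP => j; rewrite !mxE /coords linear0.
apply: inj_row_free => x xX; apply: freew.
rewrite [LHS]sum_coords big1 // => j _.
move/rowP/(_ j): xX; rewrite mulX !mxE => ->; exact: scale0r.
Qed.

End PolynomialFunctions.

(** * Elimination over the projective line *)

Section Elimination.
Variable k : closedFieldType.

(** The Nullstellensatz in one variable: a nonzero element of minimal degree
    cannot have a root [t], since reducing modulo it an element of [I] that does not
    vanish at [t] would give a nonzero element of smaller degree. *)
Lemma ideal_contains1 (I : set {poly k}) :
  (forall p q, I p -> I q -> I (p + q)) ->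
  (forall a p, I p -> I (a * p)) ->
  (forall t, exists2 p, I p & p.[t] != 0) -> I 1.
Proof.
move=> ID IM Inz; have [p0 Ip0 p0t] := Inz 0.
have p0nz : p0 != 0 by apply: contraNneq p0t => ->; rewrite horner0.
have [n] := ubnP (size p0); elim: n p0 Ip0 p0nz {p0t} => // n IH p Ip p0 sp.
have [sp1|sp1] := eqVneq (size p) 1%N.
  have /size_poly1P[c c0 pc] : size p == 1%N by rewrite sp1.
  have -> : 1 = c^-1%:P * p by rewrite pc -polyCM mulVf.
  exact: IM.
have /closed_rootP[t pt] := sp1.
have [q Iq qt] := Inz t.
have rt : (q %% p).[t] = q.[t].
  by rewrite {2}(divp_eq q p) hornerD hornerM (rootP pt) mulr0 add0r.
apply: (IH (q %% p)).
- have -> : q %% p = q + (- (q %/ p)) * p.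
    by rewrite {2}(divp_eq q p) mulNr addrC addrA addNr add0r.
  by apply: ID => //; apply: IM.
- by apply: contraNneq qt => r0; rewrite -rt r0 horner0.
by rewrite -ltnS; apply: leq_trans sp; rewrite ltnS ltn_modp.
Qed.

Section Family.
Variable V : vectType k.

Notation ring := {mpoly k[\dim {:V}]}.

Definition spec (v : V) : {rmorphism {poly ring} -> {poly k}} :=
  map_poly (meval (coords v)).

Definition eval2 (A : {poly ring}) (t : k) (v : V) : k := (spec v A).[t].

Definition vanish (P : set {poly ring}) (t : k) (v : V) : Prop :=
  forall A, P A -> eval2 A t v = 0.

(** The polynomials that vanish wherever [P] does form an ideal; specialised at [v]
    it becomes an ideal of [{poly k}] without zeros. *)
Lemma vanishing_one (P : set {poly ring}) (v : V) :
  (forall t, ~ vanish P t v) ->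
  exists2 A, spec v A = 1 & forall t w, vanish P t w -> eval2 A t w = 0.
Proof.
move=> nov.
pose J := [set A | forall t w, vanish P t w -> eval2 A t w = 0].
suff [A JA Av] : (spec v @` J) 1 by exists A.
apply: ideal_contains1.
- move=> _ _ [A JA <-] [B JB <-]; exists (A + B); last by rewrite rmorphD.
  move=> t w tw; rewrite /eval2 rmorphD hornerD.
  by rewrite [X in X + _]JA ?[X in _ + X]JB ?addr0.
- move=> a _ [A JA <-]; exists (map_poly (@mpolyC _ _) a * A).
    move=> t w tw.
    by rewrite /eval2 rmorphM hornerM [X in _ * X]JA ?mulr0.
  rewrite rmorphM; congr (_ * _); rewrite /spec /= -map_poly_comp.
  by apply: map_poly_id => c _ /=; rewrite mevalC.
move=> t; have /existsNP[A /not_implyP[PA /eqP At]] := nov t.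
by exists (spec v A) => //; exists A => // s w; apply.
Qed.

Lemma coef_spec v A i : (spec v A)`_i = (A`_i).@[coords v].
Proof. by rewrite coef_map. Qed.

(** Think of [A] and [B] as polynomials in [t = b1 / b0] and [s = b0 / b1].  The
    columns list the coefficients of forms of degree [size A + size B - 1] in [b0],
    [b1]: multiples of the homogenised [B] by monomials for [j < size A], and of the
    homogenised [A] for the others.  The multiples are chosen such that [A = B = 1]
    yields the monomial basis, that is, the identity matrix. *)
Definition elim_mx (A B : {poly ring}) : 'M[ring]_(size A + size B) :=
  \matrix_(i, j) if (j < size A)%N then (if (j <= i)%N then B`_(i - j) else 0)
                 else (if (i <= j)%N then A`_(j - i) else 0).

Lemma elim_mxE (v : V) A B i j :
  map_mx (meval (coords v)) (elim_mx A B) i j =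
  if (j < size A)%N then (if (j <= i)%N then (spec v B)`_(i - j) else 0)
  else (if (i <= j)%N then (spec v A)`_(j - i) else 0).
Proof.
by rewrite !mxE; case: ifP => _; case: ifP => _; rewrite ?coef_spec ?meval0.
Qed.

Lemma shift_sum (p : {poly k}) n j s : (size p + j <= n)%N ->
  \sum_(i < n) s ^+ i * (if (j <= i)%N then p`_(i - j) else 0) =
  s ^+ j * p.[s].
Proof.
move=> spj; have jn : (j <= n)%N by apply: leq_trans spj; rewrite leq_addl.
rewrite -(subnKC jn) big_split_ord /= big1 ?add0r => [|i _]; last first.
  by rewrite leqNgt ltn_ord mulr0.
rewrite (@horner_coef_wide _ (n - j)) ?leq_subRL // 1?addnC // mulr_sumr.
apply: eq_bigr => i _ /=.
by rewrite leq_addr addKn exprD -mulrA [_ * p`__]mulrC.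
Qed.

Lemma shift_sum_rev (p : {poly k}) n j t : (j < n)%N -> (size p <= j.+1)%N ->
  \sum_(i < n) t ^+ (n - i.+1) * (if (i <= j)%N then p`_(j - i) else 0) =
  t ^+ (n - j.+1) * p.[t].
Proof.
move=> jn spj; rewrite (reindex_inj rev_ord_inj) /=.
rewrite -(@shift_sum p n); last first.
  by rewrite -{2}(subnKC jn) leq_add2r.
apply: eq_bigr => i _; have i_n := ltn_ord i.
have -> : (n - (n - i.+1).+1 = i)%N by lia.
have -> : (n - i.+1 <= j)%N = (n - j.+1 <= i)%N by lia.
by have -> : (j - (n - i.+1) = i - (n - j.+1))%N by lia.
Qed.

(** The projection of a closed subset of [P^1 * V] to [V] is closed.  The subset is
    given by equations [P] in the chart [t] and [Q] in the chart [s = 1 / t], and the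
    hypothesis says that they agree on the overlap.  If the fibre over [v] is
    empty, there are combinations [A] of [P] and [B] of [Q] that specialise to [1]
    at [v].  Then [\det (elim_mx A B)] is [1] at [v]; and a common zero of [P] and
    [Q] over [w] makes it vanish at [w], because the vector of monomials at that
    zero is killed by all the columns. *)
Theorem elimination (P Q : set {poly ring}) :
  (forall v t, t != 0 -> vanish P t v <-> vanish Q t^-1 v) ->
  zariski_closed [set v | (exists t, vanish P t v) \/ (exists s, vanish Q s v)].
Proof.
move=> glue; apply: closed_of_separation => v /= /not_orP[/forallNP Pv /forallNP Qv].
have [A Av A0] := vanishing_one Pv; have [B Bv B0] := vanishing_one Qv.
exists (fun w => (\det (elim_mx A B)).@[coords w]); split.
- by exists (\det (elim_mx A B)).
- rewrite -det_map_mx /=; set M := map_mx _ _.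
  suff -> : M = 1%:M by rewrite det1 oner_neq0.
  apply/matrixP => i j; rewrite elim_mxE Av Bv !coef1 !mxE -val_eqE /=.
  by case: ifP => _; case: (ltngtP i j) => //= ij;
     rewrite ?ij ?subnn // ?subn_eq0 leqNgt ?ij.
move=> w Yw; rewrite -det_map_mx; apply/eqP/det0P.
have sA : (size (spec w A) <= size A)%N by apply: size_poly.
have sB : (size (spec w B) <= size B)%N by apply: size_poly.
have sA0 : (0 < size A)%N.
  rewrite lt0n size_poly_eq0; apply/eqP => A_0; move/eqP: Av.
  by rewrite A_0 rmorph0 eq_sym oner_eq0.
set n := (size A + size B)%N.
have n0 : (0 < n)%N by rewrite addn_gt0 sA0.
have [[t tw]|s0] : (exists t, vanish P t w) \/ vanish Q 0 w.
  case: Yw => [|[s sw]]; first by left.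
  have [<-|s_0] := eqVneq s 0; [by right|left; exists s^-1].
  by apply/glue; rewrite ?invr_eq0 ?invrK.
- (* the monomials b0^i b1^(n-1-i) at (b0, b1) = (1, t) *)
  exists (\row_i t ^+ (n - i.+1)).
    apply/rV0Pn; exists (Ordinal (etrans (ltn_predL n) n0)).
    by rewrite mxE /= prednK // subnn oner_neq0.
  apply/rowP => j; rewrite !mxE; under eq_bigr do rewrite mxE elim_mxE.
  have jn := ltn_ord j.
  have [jA|jA] := ltnP j (size A).
    have [t0|t0] := eqVneq t 0.
      rewrite big1 // t0 => i _; rewrite expr0n.
      have [ni|_] /= := eqVneq (n - i.+1)%N 0%N.
        rewrite mul1r; case: ifP => // _; apply: nth_default.
        have arith a b l m : (a + b - l.+1 = 0 -> l < a + b -> m < a ->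
            b <= l - m)%N by lia.
        exact: leq_trans sB (arith _ _ _ _ ni (ltn_ord i) jA).
      by rewrite mul0r.
    transitivity (t ^+ n.-1 * (t^-1 ^+ j * (spec w B).[t^-1])).
      rewrite -(@shift_sum _ n); last first.
        by rewrite addnC leq_add // ltnW.
      rewrite mulr_sumr; apply: eq_bigr => i _; rewrite mulrA; congr (_ * _).
      have i_n := ltn_ord i.
      have -> : n.-1 = (n - i.+1 + i)%N by lia.
      by rewrite exprD exprVn mulfK // expf_neq0.
    by rewrite [X in _ * (_ * X)]B0 ?mulr0 //; apply/glue.
  rewrite shift_sum_rev //; last by apply: leq_trans sA (leqW jA).
  by rewrite [X in _ * X]A0 ?mulr0.
(* the same monomials at (b0, b1) = (0, 1) *)
exists (\row_i (i == 0%N :> nat)%:R).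
  by apply/rV0Pn; exists (Ordinal n0); rewrite mxE oner_neq0.
apply/rowP => j; rewrite !mxE big1 // => i _; rewrite mxE elim_mxE.
have [i0|] := eqVneq (i : nat) 0%N; last by rewrite mul0r.
rewrite mul1r i0 subn0 leqn0; case: ltnP => jA; last first.
  by rewrite nth_default // (leq_trans sA).
case: eqVneq => // _; rewrite sub0n -horner_coef0; exact: B0.
Qed.

End Family.
End Elimination.

(** * Polynomial curves *)

Section PolynomialCurves.
Variables (k : closedFieldType) (U : vectType k).

Definition polycurve (g : k -> U) : Prop :=
  exists n (u : 'I_n -> U), forall t, g t = \sum_(i < n) t ^+ i *: u i.

Lemma polycurve_cst (u : U) : polycurve (fun=> u).
Proof. by exists 1%N, (fun=> u) => t; rewrite big_ord1 expr0 scale1r. Qed.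

Lemma polycurve_horner (g : k -> U) (p : {mpoly k[\dim {:U}]}) :
  polycurve g -> exists q : {poly k}, forall t, p.@[coords (g t)] = q.[t].
Proof.
move=> [n [u gE]].
pose h i := \sum_(j < n) coords (u j) i *: 'X^j : {poly k}.
exists (mmap (@polyC k) h p) => t.
rewrite -[RHS]/(horner_eval t _) mmap_eval => [|c]; last exact: hornerC.
apply: meval_eq => i; rewrite gE /h /coords linear_sum [RHS]horner_sum.
by apply: eq_bigr => j _; rewrite linearZ !hornerE mulrC.
Qed.

(** Along a polynomial curve in [U], a polynomial function on [U * V] becomes a
    polynomial in [t] whose coefficients are polynomial functions on [V]: the form in
    which elimination takes its equations. *)
Lemma polycurve_eval2 (V : vectType k) (g : k -> U)
    (p : {mpoly k[\dim {:(U * V)%type}]}) :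
  polycurve g ->
  exists A, forall t v, p.@[coords ((g t, v) : (U * V)%type)] = eval2 A t v.
Proof.
move=> [n [u gE]].
pose inl u : (U * V)%type := (u, 0); pose inr v : (U * V)%type := (0, v).
pose h i := \sum_(j < n) (coords (inl (u j)) i)%:MP *: 'X^j +
  (\sum_(l < \dim {:V}) coords (inr (vbasis {:V})`_l) i *: 'X_l)%:P
  : {poly {mpoly k[\dim {:V}]}}.
exists (mmap (@polyC _ \o @mpolyC _ _) h p) => t v.
pose ev : {rmorphism {poly {mpoly k[\dim {:V}]}} -> k} := horner_eval t \o spec v.
rewrite -[RHS]/(ev _) mmap_eval => [|c]; last first.
  by rewrite /= map_polyC /= [LHS]hornerC mevalC.
apply: meval_eq => i; rewrite rmorphD rmorph_sum /= map_polyC /=.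
have -> : (g t, v) = \sum_(j < n) t ^+ j *: inl (u j) +
    \sum_(l < \dim {:V}) coords v l *: inr (vbasis {:V})`_l :> (U * V)%type.
  apply: injective_projections.
    rewrite [RHS]raddfD [X in X + _]raddf_sum [X in _ + X]raddf_sum /=.
    by rewrite gE [X in _ + X]big1 ?addr0 // => l _; rewrite scaler0.
  rewrite [RHS]raddfD [X in X + _]raddf_sum [X in _ + X]raddf_sum /=.
  rewrite [X in X + _]big1 ?add0r; last by move=> l _; rewrite scaler0.
  exact: sum_coords.
rewrite /coords linearD !linear_sum; congr (_ + _).
  apply: eq_bigr => j _; rewrite linearZ /= map_polyZ /= mevalC map_polyXn.
  by rewrite /horner_eval !hornerE mulrC.
rewrite /horner_eval hornerC; apply: eq_bigr => l _.
by rewrite linearZ /= mevalZ mevalXU mulrC.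
Qed.

Lemma closed_slice (V : vectType k) (Z : set (U * V)%type) (u : U) :
  zariski_closed Z -> zariski_closed [set v | Z (u, v)].
Proof.
move=> cZ; apply: closed_of_separation => v /(closed_separated cZ)[p [pv p0]].
have [A AE] := polycurve_eval2 p (polycurve_cst u).
exists (fun v => p.@[coords ((u, v) : (U * V)%type)]); split=> //.
  by exists A`_0 => w; rewrite (AE 0) /eval2 horner_coef0 coef_spec.
by move=> w; apply: p0.
Qed.

End PolynomialCurves.

(** * Binary forms *)

Section BinaryForms.
Variable k : closedFieldType.
Implicit Types (p q : {poly k}) (a b : k).
Notation X0 := ('X_ord0 : {mpoly k[2]}).
Notation X1 := ('X_ord_max : {mpoly k[2]}).

Lemma monomial_homog l (j : 'I_l.+1) : X0 ^+ j * X1 ^+ (l - j) \is l.-homog.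
Proof.
have hX i : ('X_i : {mpoly k[2]}) \is 1.-homog by rewrite dhomogX /= mdeg1.
rewrite -[X in X.-homog](subnKC (ltn_ord j : j <= l)%N).
by apply: dhomogM; rewrite -[X in X.-homog]mul1n; apply: dhomogMn.
Qed.

Definition monomial l j : dhomog 2 k l := DHomog (@monomial_homog l j).

(** The form [(b X1)^l p(a X0 / (b X1))], for [p] of degree at most [l]. *)
Definition rescale l p a b : dhomog 2 k l :=
  \sum_(j < l.+1) (p`_j * a ^+ j * b ^+ (l - j)) *: monomial j.

(** The bihomogeneous version [y^l p(x / y)], in any commutative algebra. *)
Definition homogenise (R : comAlgType k) (x y : R) l p : R :=
  \sum_(j < l.+1) p`_j *: (x ^+ j * y ^+ (l - j)).

Lemma rescaleE l p a b :
  form_val (rescale l p a b) = homogenise (a *: X0) (b *: X1) l p.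
Proof.
rewrite /rescale /homogenise raddf_sum; apply: eq_bigr => j _.
by rewrite [LHS]linearZ /= !exprZn -scalerAl -scalerAr !scalerA.
Qed.

Section Homogenisation.
Variables (R : comAlgType k) (x y : R).

Lemma homogenise_is_linear l : linear (homogenise x y l).
Proof.
move=> c p q; rewrite /homogenise scaler_sumr -big_split; apply: eq_bigr => j _ /=.
by rewrite coefD coefZ scalerDl scalerA.
Qed.

HB.instance Definition _ l :=
  GRing.isLinear.Build k {poly k} R _ (homogenise x y l) (homogenise_is_linear l).

Lemma homogeniseXn l i : (i <= l)%N -> homogenise x y l 'X^i = x ^+ i * y ^+ (l - i).
Proof.
rewrite -ltnS => il; rewrite /homogenise (bigD1 (Ordinal il)) //= coefXn eqxx scale1r.
rewrite big1 ?addr0 // => j; rewrite -val_eqE /= coefXn => /negPf ->.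
exact: scale0r.
Qed.

Lemma homogeniseM l m p q : (size p <= l.+1)%N -> (size q <= m.+1)%N ->
  homogenise x y (l + m) (p * q) = homogenise x y l p * homogenise x y m q.
Proof.
move=> sp sq.
have pE (r : {poly k}) n : (size r <= n)%N -> r = \sum_(i < n) r`_i *: 'X^i.
  move=> sr; rewrite -poly_def -{1}(coefK r); apply/polyP => i.
  by rewrite !coef_poly; do 2 case: ltnP => // ?; rewrite nth_default //; lia.
rewrite {1}(pE p _ sp) {1}(pE q _ sq) mulr_suml linear_sum [RHS]mulr_suml.
apply: eq_bigr => i _; rewrite !mulr_sumr linear_sum; apply: eq_bigr => j _.
have -> : p`_i *: 'X^i * (q`_j *: 'X^j) = (p`_i * q`_j) *: 'X^(i + j).
  by rewrite -scalerAl -scalerAr scalerA exprD.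
rewrite [LHS]linearZ /= homogeniseXn; last by apply: leq_add; rewrite -ltnS.
have -> : (l + m - (i + j) = (l - i) + (m - j))%N.
  by have := ltn_ord i; have := ltn_ord j; lia.
by rewrite -scalerAl -scalerAr scalerA !exprD mulrACA.
Qed.

End Homogenisation.

Lemma rescaleM l m p q a b : (size p <= l.+1)%N -> (size q <= m.+1)%N ->
  form_val (rescale (l + m) (p * q) a b) =
  form_val (rescale l p a b) * form_val (rescale m q a b).
Proof. by move=> sp sq; rewrite !rescaleE homogeniseM. Qed.

Lemma rescale_eval l p a b (x : 'I_2 -> k) :
  (form_val (rescale l p a b)).@[x] =
  \sum_(j < l.+1) p`_j * (a * x ord0) ^+ j * (b * x ord_max) ^+ (l - j).
Proof.
rewrite rescaleE /homogenise raddf_sum; apply: eq_bigr => j _ /=.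
by rewrite mevalZ mevalM !rmorphXn /= !mevalZ !mevalXU mulrA.
Qed.

Lemma rescale_root l p a b r (x : 'I_2 -> k) : (size p <= l.+1)%N ->
  root p r -> a * x ord0 = r * (b * x ord_max) ->
  (form_val (rescale l p a b)).@[x] = 0.
Proof.
move=> sp pr ax; rewrite rescale_eval ax.
transitivity ((b * x ord_max) ^+ l * p.[r]); last by rewrite (rootP pr) mulr0.
rewrite (horner_coef_wide _ sp) mulr_sumr; apply: eq_bigr => j _.
have jl : (j <= l)%N by rewrite -ltnS.
have -> : (b * x ord_max) ^+ l = (b * x ord_max) ^+ j * (b * x ord_max) ^+ (l - j).
  by rewrite -exprD subnKC.
by rewrite exprMn [RHS]mulrC -!mulrA.
Qed.

End BinaryForms.

(** * Separatedness of Hbar *)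

Section Separatedness.
Variables (k : closedFieldType) (d1 d2 : nat).
Hypothesis d12 : (d1 <= d2)%N.

Notation form l := (dhomog 2 k l).
Notation U := (form d1 * form d2)%type.
Notation Hb := (Hbar k d1 d2).

Lemma form_mul_homog (K : form (d2 - d1)) (F : form d1) :
  form_val K * form_val F \is d2.-homog.
Proof. by rewrite -[X in X.-homog](subnK d12); apply: dhomogM; case: K F => ? ? []. Qed.

Definition form_mul K F : form d2 := DHomog (form_mul_homog K F).

(** [same_point] without the condition that [a] and [b] be nonzero.  The condition
    is automatic between elements of [pairs]; without it the relation makes
    sense for arbitrary [v], where it is a rank condition as long as [u] is in
    [pairs]. *)
Definition dominates (u v : U) : Prop :=
  exists a b K, v = (a *: u.1, b *: u.2 + form_mul K u.1).

Lemma dominates_trans u v w : dominates u v -> dominates v w -> dominates u w.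
Proof.
move=> [a [b [K ->]]] [a' [b' [K' ->]]].
exists (a' * a), (b' * b), (b' *: K + a *: K') => /=.
rewrite scalerA; congr pair; apply: val_inj => /=.
by rewrite scalerDr scalerA mulrDl -!scalerAl -!scalerAr addrA.
Qed.

Lemma same_point_dominates (u v : pairs k d1 d2) :
  same_point u v <-> dominates (val u) (val v).
Proof.
split=> [/asboolP[a [b [K [_ _ e1 e2]]]]|[a [b [K vE]]]].
  by exists a, b, K; apply: injective_projections; apply: val_inj.
have /asboolP[v1 v2] := valP v.
have a0 : a != 0 by apply/eqP => a0; apply: v1; rewrite vE /= a0 scale0r.
apply/asboolP; exists a, b, K; split; rewrite ?vE //.
apply/eqP => b0; apply: v2; exists (a^-1 *: K).
rewrite vE b0 scale0r add0r form_valZ [X in _ * X]form_valZ.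
by rewrite -scalerAl -scalerAr scalerA mulVf // scale1r.
Qed.

Lemma form_mul_linear (K : form (d2 - d1)) : linear (form_mul K).
Proof.
move=> a F G; apply: val_inj; rewrite /= mulrDr; congr (_ + _).
by rewrite /= -scalerAr.
Qed.

Lemma form_mul_suml n (c : 'I_n -> k) (K : 'I_n -> form (d2 - d1)) F :
  form_mul (\sum_i c i *: K i) F = \sum_i c i *: form_mul (K i) F.
Proof.
elim/big_rec2: _ => [|i L G _ <-]; apply: val_inj; first exact: mul0r.
by rewrite /= mulrDl -scalerAl.
Qed.

Notation e := (\dim {:form (d2 - d1)}).

(** For [w = (u, v)], the relation [dominates u v] says that [v.1] depends on [u.1]
    and that [v.2] depends on [u.2] and the multiples of [u.1]; the latter are
    generated by the [K u.1] with [K] in a basis. *)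
Definition fst_rows (w : (U * U)%type) (i : 'I_2) : form d1 :=
  if i == 0 then w.2.1 else w.1.1.

Definition snd_rows (w : (U * U)%type) (i : 'I_e.+2) : form d2 :=
  nth 0 [:: w.2.2, w.1.2 & [seq form_mul K w.1.1 | K <- vbasis {:form (d2 - d1)}]] i.

Definition tail_form (x : 'rV[k]_e.+2) : form (d2 - d1) :=
  \sum_(i < e) x 0 (rshift 2 i) *: (vbasis {:form (d2 - d1)})`_i.

Lemma snd_rows_sum (w : (U * U)%type) (x : 'rV[k]_e.+2) :
  \sum_i x 0 i *: snd_rows w i =
  x 0 0 *: w.2.2 + (x 0 (lift ord0 ord0) *: w.1.2 + form_mul (tail_form x) w.1.1).
Proof.
rewrite 2!big_ord_recl form_mul_suml; do 2 congr (_ + _).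
apply: eq_bigr => i _; congr (x 0 _ *: _); first exact: val_inj.
by rewrite /snd_rows /= add0n (nth_map 0) ?size_tuple.
Qed.

Lemma fst_rows_free (w : (U * U)%type) : w.1.1 != 0 ->
  row_free (\matrix_(i, j) coords (fst_rows w i) j) =
  ~~ `[< exists a, w.2.1 = a *: w.1.1 >].
Proof.
move=> w0; apply/row_free_coords/asboolPn => [free [a wE]|nw x].
  have := free (\row_i (if i == 0 then -1 else a)).
  rewrite !big_ord_recl big_ord0 !mxE /fst_rows /= wE scaleN1r addr0 addNr.
  move=> /(_ erefl).
  by move/rowP/(_ 0); rewrite !mxE => /eqP; rewrite oppr_eq0 oner_eq0.
rewrite !big_ord_recl big_ord0 addr0 /fst_rows /= => xE.
have x0 : x 0 0 = 0.
  apply/eqP/negPn/negP => x0; apply: nw; exists (- ((x 0 0)^-1 * x 0 (lift ord0 ord0))).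
  apply: (scalerI x0); rewrite scalerA mulrN mulVKf // scaleNr.
  by apply/eqP; rewrite -addr_eq0; apply/eqP.
move: xE; rewrite [x 0 ord0]x0 scale0r add0r => /eqP.
rewrite scaler_eq0 (negPf w0) orbF => /eqP x1.
apply/rowP => i; rewrite mxE; have : (i < 2)%N by []; case: (i) => [[|[|//]]] i2 _.
  by rewrite -[RHS]x0; congr (x 0 _); apply: val_inj.
by rewrite -[RHS]x1; congr (x 0 _); apply: val_inj.
Qed.

(** As [u] is a pair, [u.1] is nonzero and does not divide [u.2], so [u.2] and the
    [K u.1], with [K] in a basis, are independent: any dependence involves [v.2]. *)
Lemma snd_rows_free (u : pairs k d1 d2) (v : U) :
  row_free (\matrix_(i, j) coords (snd_rows (val u, v) i) j) =
  ~~ `[< exists b K, v.2 = b *: (val u).2 + form_mul K (val u).1 >].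
Proof.
have /asboolP[u1 u2] := valP u.
apply/row_free_coords/asboolPn => [free [b [K vE]]|nv x].
  pose x : 'rV_e.+2 := \row_i nth 0 [:: -1, b & [seq coords K i | i <- enum 'I_e]] i.
  have := free x; rewrite snd_rows_sum /=.
  have -> : tail_form x = K.
    rewrite [RHS]sum_coords; apply: eq_bigr => i _; congr (_ *: _).
    by rewrite mxE /= add0n (nth_map i) ?size_enum_ord // nth_ord_enum.
  rewrite !mxE /= vE scaleN1r addNr => /(_ erefl) /rowP/(_ 0).
  by rewrite !mxE => /eqP; rewrite oppr_eq0 oner_eq0.
rewrite snd_rows_sum /= => xE.
have form_mulZ c K F : form_mul (c *: K) F = c *: form_mul K F.
  by apply: val_inj; rewrite /= -scalerAl.
have a0 : x 0 0 = 0.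
  apply/eqP/negPn/negP => a0; apply: nv.
  exists (- ((x 0 0)^-1 * x 0 (lift ord0 ord0))), (- (x 0 0)^-1 *: tail_form x).
  apply: (scalerI a0); rewrite scalerDr form_mulZ !scalerA !mulrN mulVKf //.
  rewrite mulfV // scaleN1r scaleNr -opprD.
  by apply/eqP; rewrite -addr_eq0; apply/eqP.
move: xE; rewrite a0 scale0r add0r => xE.
have b0 : x 0 (lift ord0 ord0) = 0.
  apply/eqP/negPn/negP => b0; apply: u2.
  exists (- (x 0 (lift ord0 ord0))^-1 *: tail_form x).
  rewrite -[RHS]/(form_val (form_mul (- (x 0 (lift ord0 ord0))^-1 *: tail_form x) _)).
  congr form_val; apply: (scalerI b0); rewrite form_mulZ scalerA mulrN mulfV //.
  by rewrite scaleN1r; apply/eqP; rewrite -addr_eq0; apply/eqP.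
move: xE; rewrite b0 scale0r add0r => /(congr1 form_val)/eqP.
rewrite [X in X == _]/= [X in _ == X]/= mulf_eq0 => /orP[/eqP T0|/eqP F0]; last first.
  by case: u1; apply: val_inj.
have {}T0 : tail_form x = 0 by apply: val_inj.
have /freeP/(_ _ T0) x0 : free (vbasis {:form (d2 - d1)}).
  exact: basis_free (vbasisP _).
apply/rowP => i; rewrite mxE; case: i => [[|[|i]]] lti.
- by rewrite -[RHS]a0; congr (x 0 _); apply: val_inj.
- by rewrite -[RHS]b0; congr (x 0 _); apply: val_inj.
by rewrite -(x0 (Ordinal (lti : (i < e)%N))); congr (x 0 _); apply: val_inj.
Qed.

(** The analogue for [Hbar] of the closedness of the diagonal, that is, of
    separatedness. *)
Lemma closed_dominates :
  exists2 Z : set (U * U)%type, zariski_closed Z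
  & forall (u : pairs k d1 d2) v, Z (val u, v) <-> dominates (val u) v.
Proof.
exists ([set w | ~~ row_free (\matrix_(i, j) coords (fst_rows w i) j)] `&`
        [set w | ~~ row_free (\matrix_(i, j) coords (snd_rows w i) j)]).
  apply: closedI; apply: closed_not_row_free => i j; under eq_fun do rewrite mxE.
    apply: polyfun_coord => a v w; rewrite /fst_rows; by case: ifP.
  apply: polyfun_coord => a v w; rewrite /snd_rows.
  case: i => [[|[|i]]] lti //=.
  by rewrite !(nth_map 0) ?size_tuple // form_mul_linear.
move=> u v; have /asboolP[u1 _] := valP u; split.
  move=> [/=]; rewrite fst_rows_free ?snd_rows_free; last exact/eqP.
  move=> /negbNE/asboolP[a vE1] /negbNE/asboolP[b [K vE2]].
  by exists a, b, K; apply: injective_projections.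
move=> [a [b [K ->]]]; split=> /=; rewrite ?snd_rows_free ?fst_rows_free; last 2 first.
- exact/eqP.
- by apply/negPn/asboolP; exists b, K.
by apply/negPn/asboolP; exists a.
Qed.

End Separatedness.

(** * Rational curves in Hbar *)

Section RationalCurves.
Variables (k : closedFieldType) (d1 d2 : nat).
Hypothesis d12 : (d1 <= d2)%N.

Notation form l := (dhomog 2 k l).
Notation U := (form d1 * form d2)%type.
Notation Hb := (Hbar k d1 d2).
Notation point u := (\pi_Hb u : Hb).

Lemma same_pointP (u v : pairs k d1 d2) :
  point u = point v <-> dominates d12 (val u) (val v).
Proof.
rewrite -same_point_dominates.
have eqP : reflect (point u = point v) (same_point u v) := @eqquotP _ _ Hb u v.
by split=> /eqP.
Qed.

Lemma closed_Hbar0 : closed_Hbar (set0 : set Hb).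
Proof. by exists set0 => //; apply: closed0. Qed.

Lemma closed_HbarU (D E : set Hb) :
  closed_Hbar D -> closed_Hbar E -> closed_Hbar (D `|` E).
Proof.
move=> [Z cZ DZ] [Y cY EY]; exists (Z `|` Y); first exact: closedU.
by move=> u; split=> -[/DZ|/EY]; by [left|right].
Qed.

Lemma closed_Hbar1 (c : Hb) : closed_Hbar [set c].
Proof.
have [Z cZ ZE] := closed_dominates k d12.
exists [set v | Z (val (repr c), v)]; first exact: closed_slice.
move=> u; rewrite /= ZE -same_pointP reprK.
by split=> ->.
Qed.

(** Since points are closed, a finite set is the union of its points, and an
    irreducible set cannot be covered by finitely many closed sets without lying in
    one of them. *)
Lemma irreducible_finite (A : set Hb) (s : seq Hb) :
  irreducible (@closed_Hbar k d1 d2) A -> A `<=` [set` s] ->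
  exists c, A = [set c].
Proof.
move=> [[a Aa] irrA].
have consE (c : Hb) s' : [set` c :: s'] = [set c] `|` [set` s'].
  by apply/seteqP; split=> x /=; rewrite in_cons => /predU1P.
elim: s => [/(_ a Aa) //|c s IH As].
have cs : closed_Hbar [set` s].
  elim: s {IH As} => [|x s IH]; first by rewrite set_nil; exact: closed_Hbar0.
  by rewrite consE; apply: closed_HbarU => //; exact: closed_Hbar1.
have [|Ac|/IH //] := irrA [set c] [set` s] (closed_Hbar1 c) cs.
  by rewrite -consE.
exists c; apply/seteqP; split=> // x ->.
by rewrite -(Ac a Aa).
Qed.

Variables (u0 u1 : k -> pairs k d1 d2).
Hypotheses (poly_u0 : polycurve (fun t => val (u0 t)))
           (poly_u1 : polycurve (fun s => val (u1 s))).
Hypothesis glue : forall t, t != 0 -> point (u0 t) = point (u1 t^-1).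

Definition ratcurve : set Hb :=
  [set c | (exists t, c = point (u0 t)) \/ (exists s, c = point (u1 s))].

Lemma ratcurveE c : ratcurve c <-> (exists t, c = point (u0 t)) \/ c = point (u1 0).
Proof.
split=> [[|[s ->]]|[|->]]; [by left| |by left|by right; exists 0].
have [->|s0] := eqVneq s 0; [by right|left; exists s^-1].
by rewrite glue ?invr_eq0 // invrK.
Qed.

(** Pulling [D] back to both charts of P^1 gives equations to which [elimination]
    applies; they agree on the overlap because [D] only depends on the point of
    [Hbar]. *)
Lemma ratcurve_proper (V : vectType k) (D : set (Hb * V)) :
  closed_HbarX D -> zariski_closed [set v | exists2 c, ratcurve c & D (c, v)].
Proof.
move=> [_ [I ->] DI].
pose eqs (g : k -> pairs k d1 d2) : set {poly {mpoly k[\dim {:V}]}} :=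
  [set A | exists2 p, I p &
    forall t v, p.@[coords ((val (g t), v) : (U * V)%type)] = eval2 A t v].
have eqsP g t v : polycurve (fun t => val (g t)) ->
    vanish (eqs g) t v <-> D (point (g t), v).
  move=> polyg; rewrite DI; split=> [van p Ip|Dg A [p Ip <-]]; last exact: Dg.
  have [A AE] := polycurve_eval2 p polyg.
  by rewrite [LHS]AE; apply: van; exists p.
rewrite (_ : [set v | _] = [set v | (exists t, vanish (eqs u0) t v) \/
                              (exists s, vanish (eqs u1) s v)]).
  by apply: elimination => v t t0; rewrite !eqsP // glue.
apply/seteqP; split=> v.
  by move=> [c [[t ->]|[t ->]] Dc]; [left|right]; exists t; apply/eqsP.
by move=> [[t /eqsP-/(_ poly_u0) Dt]|[t /eqsP-/(_ poly_u1) Dt]];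
   eexists; try exact: Dt; [left|right]; exists t.
Qed.

(** Project the relation [dominates] along the curve: a pair lies over the curve
    exactly when some point of the curve dominates it. *)
Lemma ratcurve_closed : closed_Hbar ratcurve.
Proof.
have [Z cZ ZE] := closed_dominates k d12.
pose D : set (Hb * U) := [set w | Z (val (repr w.1), w.2)].
have ZD (u : pairs k d1 d2) v : D (point u, v) <-> Z (val u, v).
  have ru : point (repr (point u)) = point u by rewrite reprK.
  by rewrite /D /= !ZE; split; apply: dominates_trans; apply/same_pointP.
eexists; first by apply: (@ratcurve_proper _ D); exists Z.
move=> v; split=> [Cv|[c Cc]] /=.
  exists (point v) => //; apply/ZD/ZE; exact/same_pointP.
by rewrite -[c]reprK => /ZD/ZE/same_pointP; rewrite reprK => <-.
Qed.

Lemma ratcurve_complete : complete ratcurve.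
Proof.
move=> n W [D cD ->].
rewrite (_ : snd @` _ = [set v | exists2 c, ratcurve c & D (c, v)]).
  exact: ratcurve_proper.
apply/seteqP; split=> [_ [[c v] [[Cc _] Dcv] <-]|v [c Cc Dcv]]; first by exists c.
by exists (c, v).
Qed.

(** Pull back an equation of [D] that does not vanish at some point of the curve.
    If that point is only in the chart of [u1], the polynomial [q] obtained in
    [s = 1 / t] is turned into the polynomial [t^n q(1 / t)]. *)
Lemma ratcurve_avoid (D : set Hb) : closed_Hbar D -> ~ ratcurve `<=` D ->
  exists2 q : {poly k}, q != 0 & forall t, D (point (u0 t)) -> q.[t] = 0.
Proof.
move=> [Z cZ DZ] /existsNP[c /not_implyP[/ratcurveE[[t ->]|->]]];
    rewrite DZ => /(closed_separated cZ)[p [pc p0]].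
  have [q qE] := polycurve_horner p poly_u0.
  exists q => [|s]; last by rewrite DZ -qE => /p0.
  by apply: contraNneq pc => q0; rewrite qE q0 horner0.
have [q qE] := polycurve_horner p poly_u1.
pose n := size q; pose r := \poly_(i < n.+1) q`_(n - i).
have rE t : t != 0 -> r.[t] = t ^+ n * q.[t^-1].
  move=> t0; rewrite horner_poly (@horner_coef_wide _ n.+1) ?leqnSn // mulr_sumr.
  rewrite (reindex_inj rev_ord_inj); apply: eq_bigr => i _ /=.
  rewrite subSS subKn -1?ltnS // exprVn mulrCA; congr (_ * _).
  have le_in : (i <= n)%N by rewrite -ltnS.
  have -> : t ^+ n = t ^+ (n - i) * t ^+ i by rewrite -exprD subnK.
  by rewrite mulfK // expf_neq0.
exists r => [|t].
  apply: contraNneq pc => r0; rewrite qE horner_coef0.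
  have := coef_poly n.+1 (fun i => q`_(n - i)) n.
  by rewrite -/r r0 coef0 ltnSn subnn => <-.
have [->|t0] := eqVneq t 0.
  by rewrite horner_coef0 coef_poly /= subn0 nth_default.
by rewrite rE // glue // DZ -qE => /p0 ->; rewrite mulr0.
Qed.

Lemma ratcurve_irreducible : irreducible (@closed_Hbar k d1 d2) ratcurve.
Proof.
split; first by exists (point (u0 0)); left; exists 0.
move=> D E cD cE CDE; apply: contrapT => /not_orP[].
move=> /(ratcurve_avoid cD)[q q0 qD] /(ratcurve_avoid cE)[r r0 rE].
have /closed_nonrootP[t] : q * r != 0 by rewrite mulf_neq0.
rewrite /root hornerM => /negP; apply.
have /CDE[/qD->|/rE->] : ratcurve (point (u0 t)) by left; exists t.
  by rewrite mul0r.
by rewrite mulr0.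
Qed.

Lemma ratcurve_finite (D : set Hb) : closed_Hbar D -> ~ ratcurve `<=` D ->
  exists s : seq Hb, ratcurve `&` D `<=` [set` s].
Proof.
move=> cD /(ratcurve_avoid cD)[q q0 qD].
have [r qE] := closed_field_poly_normal q.
exists (point (u1 0) :: [seq point (u0 t) | t <- r]) => c.
move=> [/ratcurveE[[t ->] Dt|-> _]] /=.
  rewrite in_cons map_f ?orbT // -root_prod_XsubC.
  by rewrite -(rootZ _ _ (_ : lead_coef q != 0)) ?lead_coef_eq0 // -qE; apply/eqP/qD.
by rewrite in_cons eqxx.
Qed.

(** In a chain of length two, the middle term is a proper closed subset of the
    curve, hence finite, hence a point by irreducibility; nothing irreducible is
    strictly smaller. *)
Lemma ratcurve_dim1 : point (u0 0) <> point (u1 0) ->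
  has_krull_dim (@closed_Hbar k d1 d2) ratcurve 1.
Proof.
move=> u01; have C0 : ratcurve (point (u0 0)) by left; exists 0.
have C1 : ratcurve (point (u1 0)) by right; exists 0.
split.
  exists (fun i => if i is 0%N then [set point (u0 0)] else ratcurve); split.
    case=> [|i] _; split; last first.
    - by exists ratcurve; [exact: ratcurve_closed|rewrite setIid].
    - exact: ratcurve_irreducible.
    - exists [set point (u0 0)]; first exact: closed_Hbar1.
      by apply/seteqP; split=> [c ->|c []].
    - split; first by exists (point (u0 0)).
      by move=> D E _ _ /(_ _ erefl)[Dc|Ec]; [left|right] => c ->.
  case=> // _; split=> [c -> //|/(_ _ C1)] /= /esym; exact: u01.
move=> m Z [irrZ ltZ]; rewrite leqNgt; apply/negP => m1.
have [irr1 [D cD ZD]] := irrZ 1%N (ltnW m1).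
have [_ [E _ ZE]] := irrZ 2%N m1.
have nCD : ~ ratcurve `<=` D.
  move=> CD; have [_] := ltZ 1%N m1; apply; rewrite ZD ZE => c [Cc _].
  by split=> //; apply: CD.
have [s Cs] := ratcurve_finite cD nCD; rewrite -ZD in Cs.
have [c Z1] := irreducible_finite irr1 Cs.
have [[[a Za] _] _] := irrZ 0%N (leq0n m).
have [Z01 []] := ltZ 0%N (ltnW m1); rewrite Z1 => x ->.
by have := Z01 _ Za; rewrite Z1 => <-.
Qed.

End RationalCurves.

(** * The curve *)

Section Factor.
Variable k : closedFieldType.

Lemma factor_split (p : {poly k}) m n : p \is monic -> size p = (m + n).+1 ->
  exists f g : {poly k}, [/\ size f = m.+1, size g = n.+1 & f * g = p].
Proof.
move=> /monicP p1 sp; have [r pE] := closed_field_poly_normal p.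
rewrite p1 scale1r in pE.
have sr : size r = (m + n)%N.
  by have := sp; rewrite pE size_prod_XsubC => -[].
exists (\prod_(z <- take m r) ('X - z%:P)), (\prod_(z <- drop m r) ('X - z%:P)).
rewrite !size_prod_XsubC size_takel ?size_drop sr ?leq_addr // addKn; split=> //.
by rewrite -big_cat cat_take_drop.
Qed.

Lemma rescale_eval_x0 l (p : {poly k}) a b (x : 'I_2 -> k) : x ord_max = 0 ->
  (form_val (rescale l p a b)).@[x] = p`_l * (a * x ord0) ^+ l.
Proof.
move=> x1; rewrite rescale_eval x1 mulr0 big_ord_recr /= subnn mulr1 big1 ?add0r //.
by move=> i _; rewrite expr0n subn_eq0 leqNgt ltn_ord mulr0.
Qed.

Lemma rescale_eval_x1 l (p : {poly k}) a b (x : 'I_2 -> k) : x ord0 = 0 ->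
  (form_val (rescale l p a b)).@[x] = p`_0 * (b * x ord_max) ^+ l.
Proof.
move=> x0; rewrite rescale_eval x0 mulr0 big_ord_recl /= subn0 mulr1 big1 ?addr0 //.
by move=> i _; rewrite expr0n mulr0 mul0r.
Qed.

Lemma point_eq0 (x : 'I_2 -> k) i : x ord0 = 0 -> x ord_max = 0 -> x i = 0.
Proof.
move=> x0 x1; have [<- //|<- //] : ord0 = i \/ ord_max = i.
by case: i => [[|[|//]]] i2; [left|right]; apply: val_inj.
Qed.

Lemma monomial_eval l (j : 'I_l.+1) (x : 'I_2 -> k) :
  (form_val (monomial k j)).@[x] = x ord0 ^+ j * x ord_max ^+ (l - j).
Proof. by rewrite mevalM !rmorphXn /= !mevalXU. Qed.

End Factor.

Section Curve.
Variables (k : closedFieldType) (d1 d2 : nat).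
Hypotheses (d1_gt0 : (0 < d1)%N) (d12 : (d1 < d2)%N).
Variables f g : {poly k}.
Hypotheses (size_f : size f = d1.+1) (size_g : size g = (d2 - d1).+1)
           (fg : f * g = 'X^d2 - 1).

Let d2_gt0 : (0 < d2)%N. Proof. exact: ltn_trans d12. Qed.

Definition point2 (a b : k) (i : 'I_2) : k := if i == ord0 then a else b.

Lemma coef0_neq0 : f`_0 != 0.
Proof.
suff: f.[0] * g.[0] != 0 by rewrite mulf_eq0 horner_coef0 => /norP[].
rewrite -hornerM fg !hornerE expr0n eqn0Ngt d2_gt0 sub0r.
by rewrite oppr_eq0 oner_eq0.
Qed.

Lemma coef_d1_neq0 : f`_d1 != 0.
Proof.
by rewrite -[d1]/(d1.+1.-1) -size_f -lead_coefE lead_coef_eq0 -size_poly_eq0 size_f.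
Qed.

Lemma f_root : exists2 r, r != 0 & root f r.
Proof.
have /closed_rootP[r fr] : size f != 1%N by rewrite size_f eqSS -lt0n.
exists r => //; apply: contraNneq coef0_neq0 => r0.
by move: fr; rewrite r0 /root horner_coef0.
Qed.

(** [F_(t,1)] and [F_(1,s)], with the second form that has no zero in common with
    them. *)
Definition chart0 (t : k) : dhomog 2 k d1 * dhomog 2 k d2 :=
  (rescale d1 f t 1, monomial k ord_max).
Definition chart1 (s : k) : dhomog 2 k d1 * dhomog 2 k d2 :=
  (rescale d1 f 1 s, monomial k ord0).

(** A form [F] cannot divide [G] if it has a zero that is not a zero of [G]. *)
Lemma is_pair_eval (F : dhomog 2 k d1) (G : dhomog 2 k d2) x y :
  (form_val F).@[y] != 0 -> (form_val F).@[x] = 0 -> (form_val G).@[x] != 0 ->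
  is_pair (F, G).
Proof.
move=> Fy Fx Gx; apply/asboolP; split=> /= [F0|[K GE]].
  by move/eqP: Fy; apply; rewrite F0 [form_val 0](_ : _ = 0) // meval0.
by move: Gx; rewrite GE mevalM Fx mulr0 eqxx.
Qed.

(** The form [F_(t,1)] vanishes at [(r : t)] for any root [r] of [f], and [X0^d2] does
    not. *)
Lemma chart0_pair t : is_pair (chart0 t).
Proof.
have [r r0 fr] := f_root.
apply: (@is_pair_eval _ _ (point2 r t) (point2 0 1)).
- by rewrite rescale_eval_x1 // /point2 /= !mul1r expr1n mulr1 coef0_neq0.
- by apply: (@rescale_root _ _ _ _ _ r); rewrite ?size_f // /point2 /= mul1r mulrC.
by rewrite monomial_eval subnn mulr1 expf_neq0.
Qed.

Lemma chart1_pair s : is_pair (chart1 s).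
Proof.
have [r r0 fr] := f_root.
apply: (@is_pair_eval _ _ (point2 (r * s) 1) (point2 1 0)).
- by rewrite rescale_eval_x0 // /point2 /= !mul1r expr1n mulr1 coef_d1_neq0.
- by apply: (@rescale_root _ _ _ _ _ r); rewrite ?size_f // /point2 /= mul1r mulr1.
by rewrite monomial_eval expr0 mul1r expr1n oner_neq0.
Qed.

Definition u0 t : pairs k d1 d2 := Sub (chart0 t) (chart0_pair t).
Definition u1 s : pairs k d1 d2 := Sub (chart1 s) (chart1_pair s).

Lemma polycurve_pair (c : 'I_d1.+1 -> dhomog 2 k d1) (G : dhomog 2 k d2) :
  polycurve (fun t => (\sum_(i < d1.+1) t ^+ i *: c i, G)).
Proof.
exists d1.+1, (fun i => (c i, if i == ord0 then G else 0)) => t.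
apply: injective_projections; first by rewrite [RHS]raddf_sum.
rewrite [RHS]raddf_sum [RHS](bigD1 ord0) //= [X in _ + X]big1 => [|i /negPf ->].
  by rewrite addr0 scale1r.
exact: scaler0.
Qed.

Lemma polycurve_u0 : polycurve (fun t => val (u0 t)).
Proof.
rewrite (_ : (fun _ => _) = fun t =>
  (\sum_(i < d1.+1) t ^+ i *: (f`_i *: monomial k i), monomial k ord_max)).
  exact: polycurve_pair.
apply: funext => t; congr pair; apply: eq_bigr => i _.
by rewrite expr1n mulr1 scalerA mulrC.
Qed.

Lemma polycurve_u1 : polycurve (fun s => val (u1 s)).
Proof.
rewrite (_ : (fun _ => _) = fun s =>
  (\sum_(i < d1.+1) s ^+ i *: (f`_(d1 - i) *: monomial k (rev_ord i)),
   monomial k ord0)).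
  exact: polycurve_pair.
apply: funext => s; congr pair; rewrite [LHS](reindex_inj rev_ord_inj).
apply: eq_bigr => i _ /=; rewrite subSS subKn -1?ltnS //.
by rewrite expr1n mulr1 scalerA mulrC.
Qed.

(** Modulo [F_(t,1)], which is [t^d1 F_(1,1/t)], the forms [X1^d2] and [t^d2 X0^d2]
    are congruent: their difference is the homogenisation of [f g = Z^d2 - 1]. *)
Lemma charts_glue t : t != 0 ->
  \pi_(Hbar k d1 d2) (u0 t) = \pi_(Hbar k d1 d2) (u1 t^-1).
Proof.
move=> t0; apply/(same_pointP (ltnW d12)).
exists (t ^- d1), (t ^+ d2), (- rescale (d2 - d1) g t 1).
apply: injective_projections; rewrite /=.
  rewrite scaler_sumr; apply: eq_bigr => i _; rewrite scalerA !expr1n !mulr1 mulrCA.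
  congr (_ * _ *: _).
  have -> : t ^+ d1 = t ^+ (d1 - i) * t ^+ i by rewrite -exprD subnK // -ltnS.
  by rewrite invfM -mulrA mulVf ?mulr1 ?expf_neq0 // exprVn.
have fgE := rescaleM t 1 (eq_leq size_f) (eq_leq size_g).
rewrite fg rescaleE subnKC ?(ltnW d12) // raddfB /= in fgE.
rewrite homogeniseXn // -(expr0 'X) homogeniseXn // [RHS]mulrC in fgE.
apply: val_inj; rewrite /= mulNr -{}fgE.
by rewrite subnn subn0 !expr0 !mulr1 !mul1r scale1r exprZn opprB addrC subrK.
Qed.

Lemma u0_neq_u1 : \pi_(Hbar k d1 d2) (u0 0) <> \pi_(Hbar k d1 d2) (u1 0).
Proof.
move=> /(same_pointP (ltnW d12))[a [b [K /(congr1 fst)/(congr1 form_val)]]].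
move=> /(congr1 (meval (point2 1 0))) /=.
rewrite mevalZ !rescale_eval_x0 // /point2 /= mul0r mul1r expr1n mulr1.
by rewrite expr0n eqn0Ngt d1_gt0 !mulr0 => /eqP; rewrite (negPf coef_d1_neq0).
Qed.

(** At a zero of [X0^d2] the form [F_(t,1)] reduces to [f_0 X1^d1]; symmetrically, at a
    zero of [X1^d2] the form [F_(1,s)] reduces to [f_d1 X0^d1]. *)
Lemma ratcurve_Hset : ratcurve u0 u1 `<=` @Hset k d1 d2.
Proof.
move=> c [[t ->]|[s ->]]; [exists (u0 t)|exists (u1 s)] => //.
  move=> [x [[i xi] F0 G0]].
  have {}F0 : (form_val (rescale d1 f t 1)).@[x] = 0 := F0.
  have {G0}/eqP : (form_val (monomial k (@ord_max d2))).@[x] = 0 := G0.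
  rewrite monomial_eval subnn mulr1 expf_eq0 d2_gt0 => /eqP x0.
  move/eqP: F0; rewrite rescale_eval_x1 // mul1r mulf_eq0 (negPf coef0_neq0) expf_eq0.
  by rewrite d1_gt0 => /eqP x1; rewrite point_eq0 ?eqxx in xi.
move=> [x [[i xi] F0 G0]].
have {}F0 : (form_val (rescale d1 f 1 s)).@[x] = 0 := F0.
have {G0}/eqP : (form_val (monomial k (@ord0 d2))).@[x] = 0 := G0.
rewrite monomial_eval mul1r subn0 expf_eq0 d2_gt0 => /eqP x1.
move/eqP: F0; rewrite rescale_eval_x0 // mul1r mulf_eq0 (negPf coef_d1_neq0) expf_eq0.
by rewrite d1_gt0 => /eqP x0; rewrite point_eq0 ?eqxx in xi.
Qed.

Theorem ratcurve_complete_curve : complete_curve_in_H (ratcurve u0 u1).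
Proof.
have le_d12 := ltnW d12.
split.
- split; first exact: ratcurve_Hset.
  exists (ratcurve u0 u1).
    exact: (ratcurve_closed le_d12 polycurve_u0 polycurve_u1 charts_glue).
  by apply/esym/setIidr; exact: ratcurve_Hset.
- exact: (ratcurve_irreducible polycurve_u0 polycurve_u1 charts_glue).
- exact: (ratcurve_dim1 le_d12 polycurve_u0 polycurve_u1 charts_glue u0_neq_u1).
exact: (ratcurve_complete polycurve_u0 polycurve_u1 charts_glue).
Qed.

End Curve.

Theorem corollary0p10 (k : closedFieldType) (d1 d2 : nat)
    (hd1 : (1 <= d1)%N) (hd12 : (d1 < d2)%N) :
  exists C : set (Hbar k d1 d2), complete_curve_in_H C.
Proof.
have d2_gt0 : (0 < d2)%N by exact: ltn_trans hd12.
have [f [g [sf sg fg]]] : exists f g : {poly k},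
    [/\ size f = d1.+1, size g = (d2 - d1).+1 & f * g = 'X^d2 - 1].
  apply: factor_split; first exact: monic_Xn_sub_1.
  by rewrite size_Xn_sub_1 // subnKC // ltnW.
eexists; exact: (ratcurve_complete_curve hd1 hd12 sf sg fg).
Qed.
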